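(* Let $\mathcal{M}^{II}_m$ be a timelike second kind meridian surface of hyperbolic type in $\mathbb{R}^4_1$, parametrized by $z(u,v)=f(u)\,l(v)+g(u)\,e_1$, $u\in I$, $v\in J$. Then $\mathcal{M}^{II}_m$ has non-zero constant mean curvature, i.e. $\|H\|=a=\mathrm{const}$, $a\neq0$, if and only if the curve $l=l(v)$ on $\mathbb{H}^2(-1)$ has constant non-zero curvature $\varkappa=b=\mathrm{const}$, $b\neq0$, and the meridian curve $m:u\mapsto(f(u),g(u))$ is given by $\dot f=\varphi(f)$, where $$\varphi(t)=\pm\sqrt{1+\frac1{t^2}\left(c\pm\frac t2\sqrt{4a^2t^2-b^2}\mp\frac{b^2}{4a}\ln\left|2at+\sqrt{4a^2t^2-b^2}\right|\right)^2},\qquad c=\mathrm{const},$$ and the function $g(u)$ is defined by $\dot g=\pm\sqrt{\dot f^2-1}$.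
   Context: $\mathbb{R}^4_1$ is the Minkowski 4-space with metric $\langle\cdot,\cdot\rangle = dx_1^2+dx_2^2+dx_3^2-dx_4^2$ and standard orthonormal frame $e_1,e_2,e_3,e_4$ ($e_4$ timelike). $\mathbb{H}^2(-1)=\{V\in\mathrm{span}\{e_2,e_3,e_4\}:\langle V,V\rangle=-1,\ \text{the } e_4\text{-coordinate of }V\text{ is positive}\}$. A timelike second kind meridian surface of hyperbolic type is the surface $z(u,v)=f(u)l(v)+g(u)e_1$, where $I,J\subset\mathbb{R}$ are intervals, $f,g:I\to\mathbb{R}$ are smooth with $f>0$, and $l:J\to\mathbb{H}^2(-1)$ is a smooth curve with $\langle l',l'\rangle=1$ (prime $=d/dv$). The meridian curve is normalized by $\dot f^2-\dot g^2=1$ (dot $=d/du$), so the induced metric $-du^2+f(u)^2dv^2$ is Lorentzian. The curvature of $l$ is $\varkappa(v)=\langle t'(v),n(v)\rangle$, where $t=l'$ and $\{l,t,n\}$ is an orthonormal frame field of $\mathrm{span}\{e_2,e_3,e_4\}$ with $\langle n,n\rangle=1$ (so $t'=\varkappa n+l$, $n'=-\varkappa t$). The mean curvature vector field is $H=\frac12(\sigma(x,x)-\sigma(y,y))$, with $\sigma$ the second fundamental form and $\{x,y\}$ an orthonormal tangent frame with $\langle x,x\rangle=1$, $\langle y,y\rangle=-1$; $\|H\|=\sqrt{\langle H,H\rangle}$ (the normal bundle is positive definite). In the formula for $\varphi$, the two inner signs $\pm,\mp$ are taken correspondingly (both upper or both lower), independently of the outer sign.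
   Formalization: The curvature ϰ of l is assumed not identically zero on J: for a geodesic l (ϰ≡0), f=sinh(au)/a, g=cosh(au)/a gives ‖H‖=a, so ''only if'' fails as printed. The sign in ġ=±√(ḟ²−1) may vary with u, and 4a²f²−b²≥0 is stated explicitly. *)

(* Defs.v *)
From HB Require Import structures.
From mathcomp Require Import all_boot all_order all_algebra.
From mathcomp Require Import all_classical all_reals all_analysis.
Set Implicit Arguments.
Unset Strict Implicit.
Unset Printing Implicit Defensive.
Import Order.TTheory GRing.Theory Num.Theory.
Import numFieldNormedType.Exports.
Local Open Scope ring_scope.
Local Open Scope classical_set_scope.

(* The coordinates x_1, ..., x_4 of R^4_1 are the row-vector entries 0, ..., 3. *)
Definition mink {R : realType} (v w : 'rV[R]_4) : R :=
  v 0 0 * w 0 0 + v 0 1 * w 0 1 + v 0 2 * w 0 2 - v 0 3 * w 0 3.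

Definition mink_norm {R : realType} (v : 'rV[R]_4) : R := Num.sqrt (mink v v).

Definition e1 {R : realType} : 'rV[R]_4 := delta_mx 0 0.

Definition span_e2_e3_e4 {R : realType} : set 'rV[R]_4 := [set V | V 0 0 = 0].

Definition hyperbolic_plane {R : realType} : set 'rV[R]_4 :=
  [set V | [/\ span_e2_e3_e4 V, mink V V = -1 & 0 < V 0 3]].

Definition proper_itv {R : realType} (I : interval R) : Prop :=
  [set` I]° !=set0.

(* The interval may contain its endpoints, so smoothness is required on a
   neighbourhood of each point; the two-sided derivatives of h at points of I
   are then determined by the restriction of h to I. *)
Definition smooth_on {R : realType} {V : normedModType R} (I : interval R)
    (h : R -> V) : Prop :=
  forall t, t \in I -> \forall s \near t, forall k, derivable (derive1n k h) s 1.

Section ParametrizedSurface.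
Context {R : realType}.
Variable z : R -> R -> 'rV[R]_4.

Definition partial_u (w : R -> R -> 'rV[R]_4) (u v : R) : 'rV[R]_4 :=
  derive1 (fun s => w s v) u.
Definition partial_v (w : R -> R -> 'rV[R]_4) (u v : R) : 'rV[R]_4 :=
  derive1 (w u) v.

(* A tangent vector at z u v is given by its components X in the basis
   (z_u, z_v). *)
Definition tangent_vector (u v : R) (X : R * R) : 'rV[R]_4 :=
  X.1 *: partial_u z u v + X.2 *: partial_v z u v.

(* The component of w orthogonal to the tangent plane: the tangential part is
   obtained by inverting the Gram matrix of (z_u, z_v), which is invertible
   whenever the induced metric is nondegenerate. *)
Definition normal_part (u v : R) (w : 'rV[R]_4) : 'rV[R]_4 :=
  let zu := partial_u z u v in
  let zv := partial_v z u v in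
  let E := mink zu zu in
  let F := mink zu zv in
  let G := mink zv zv in
  let D := E * G - F ^+ 2 in
  w - ((G * mink w zu - F * mink w zv) / D) *: zu
    - ((E * mink w zv - F * mink w zu) / D) *: zv.

Definition second_fundamental_form (u v : R) (X Y : R * R) : 'rV[R]_4 :=
  normal_part u v
    ((X.1 * Y.1) *: partial_u (partial_u z) u v
     + (X.1 * Y.2 + X.2 * Y.1) *: partial_v (partial_u z) u v
     + (X.2 * Y.2) *: partial_v (partial_v z) u v).

Definition orthonormal_tangent_frame (u v : R) (X Y : R * R) : Prop :=
  [/\ mink (tangent_vector u v X) (tangent_vector u v X) = 1,
      mink (tangent_vector u v Y) (tangent_vector u v Y) = -1
    & mink (tangent_vector u v X) (tangent_vector u v Y) = 0].

(* Meant for X, Y an orthonormal tangent frame at (u, v), on the choice of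
   which the value does not depend. *)
Definition mean_curvature_vector (u v : R) (X Y : R * R) : 'rV[R]_4 :=
  2^-1 *: (second_fundamental_form u v X X - second_fundamental_form u v Y Y).

End ParametrizedSurface.

Definition meridian_surface {R : realType} (f g : R -> R) (l : R -> 'rV[R]_4)
    (u v : R) : 'rV[R]_4 := f u *: l v + g u *: e1.

Record timelike_meridian_data {R : realType} (I J : interval R)
    (f g : R -> R) (l : R -> 'rV[R]_4) : Prop := TimelikeMeridianData {
  meridian_dom_u : proper_itv I;
  meridian_dom_v : proper_itv J;
  meridian_smooth_f : smooth_on I f;
  meridian_smooth_g : smooth_on I g;
  meridian_f_gt0 : forall u, u \in I -> 0 < f u;
  meridian_normalized :
    forall u, u \in I -> (derive1 f u) ^+ 2 - (derive1 g u) ^+ 2 = 1;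
  meridian_smooth_l : smooth_on J l;
  meridian_l_in : forall v, v \in J -> hyperbolic_plane (l v);
  meridian_l_unit : forall v, v \in J -> mink (derive1 l v) (derive1 l v) = 1 }.

(* With t = l', states that {l, t, n} is an orthonormal frame field of
   span{e_2, e_3, e_4} along l, the conditions on l and t alone being part of
   timelike_meridian_data. *)
Record normal_field {R : realType} (J : interval R) (l n : R -> 'rV[R]_4)
    : Prop := NormalField {
  normal_smooth : smooth_on J n;
  normal_in_span : forall v, v \in J -> span_e2_e3_e4 (n v);
  normal_unit : forall v, v \in J -> mink (n v) (n v) = 1;
  normal_orth_l : forall v, v \in J -> mink (n v) (l v) = 0;
  normal_orth_t : forall v, v \in J -> mink (n v) (derive1 l v) = 0 }.

Definition curvature {R : realType} (l n : R -> 'rV[R]_4) (v : R) : R :=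
  mink (derive1 (derive1 l) v) (n v).

(* Signs are booleans: (-1) ^+ outer is the sign in front of the square root,
   (-1) ^+ inner the upper sign of the corresponding pair inside it. *)
Definition phi {R : realType} (outer inner : bool) (a b c t : R) : R :=
  let r := Num.sqrt (4 * a ^+ 2 * t ^+ 2 - b ^+ 2) in
  (-1) ^+ outer *
  Num.sqrt (1 + (t ^+ 2)^-1 *
    (c + (-1) ^+ inner * (t / 2 * r)
       - (-1) ^+ inner * (b ^+ 2 / (4 * a) * ln `|2 * a * t + r|)) ^+ 2).

(* Since Num.sqrt is 0 on negative numbers, the condition that phi be defined
   along f, i.e. that the radicand 4 a^2 t^2 - b^2 be nonnegative, is explicit.
   The sign in the equation for g' is pointwise: f * g' may change sign
   once on I, at the zero of the expression squared in phi. *)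
Definition meridian_given_by_phi {R : realType} (I : interval R)
    (f g : R -> R) (a b : R) : Prop :=
  exists (outer inner : bool) (c : R), forall u, u \in I ->
    [/\ 0 <= 4 * a ^+ 2 * f u ^+ 2 - b ^+ 2,
        derive1 f u = phi outer inner a b c (f u)
      & derive1 g u = Num.sqrt ((derive1 f u) ^+ 2 - 1) \/
        derive1 g u = - Num.sqrt ((derive1 f u) ^+ 2 - 1)].

(* Main.v *)
Require Import Defs.
From mathcomp Require Import all_boot all_order all_algebra.
From mathcomp Require Import all_classical all_reals all_analysis.
From mathcomp Require Import ring lra.
Set Implicit Arguments.
Unset Strict Implicit.
Unset Printing Implicit Defensive.
Import Order.TTheory GRing.Theory Num.Theory.
Import numFieldNormedType.Exports.
Local Open Scope ring_scope.
Local Open Scope classical_set_scope.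

(** Put w = f g'. In the orthonormal normal frame n, g' l + f' e1 the mean
curvature vector has components k / (2 f) and - w' / (2 f f') up to sign, where
k is the curvature of l; the second uses f' f'' = g' g'', the derivative of
f'^2 - g'^2 = 1. Hence (mink_mean_curvature)

  4 f^2 <H, H> = k^2 + (w' / f')^2,

where f' never vanishes because f'^2 = 1 + g'^2. So ||H|| = a is the equation
(w' / f')^2 = 4 a^2 f^2 - k^2 at every (u, v). Separating the variables, k^2 is
constant, and since k is continuous and not zero, k is a constant b.

It remains to compare the equation (w' / f')^2 = 4 a^2 f^2 - b^2 with the
equations for f' and g'. The function

  psi(t) = t/2 r - b^2/(4a) ln |2at + r|,  r = sqrt (4 a^2 t^2 - b^2),

is a primitive of r (is_derive_phi_primitive). If the radicand
4 a^2 f^2 - b^2 is nonnegative on I, it is positive in the interior of I,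
because a zero there would be a local minimum of the radicand along f, and its
derivative 8 a^2 f f' does not vanish (radicand_gt0_interior).

Assume the equation for w'. In the interior w' / f' is continuous and does not
vanish, so it has a constant sign, w' = +- r(f) f' = +- psi(f)', and
w = c +- psi(f); by continuity this holds on all of I. Substituting
g' = (c +- psi(f)) / f in f'^2 = 1 + g'^2 and taking the constant sign of f'
gives f' = phi(f) (meridian_given_by_phi_of_ode).

Conversely f' = phi(f) only says that w^2 = P^2 for P = c +- psi(f), and the
sign of w / P may change where both vanish. Still, two differentiable functions
with equal squares have derivatives with equal squares (derive_sqr_eq), so
w'^2 = P'^2 = r(f)^2 f'^2 in the interior, and on I by continuity
(ode_of_meridian_given_by_phi). *)

(** * Calculus on an interval *)

Section Calculus.
Context {R : realType}.
Implicit Types (I : interval R) (f g h : R -> R) (s t u x : R).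

(** The derivation rules are restated for functions written pointwise, the form
in which they arise here, so that they chain without unification up to the ring
structure on functions. *)
Lemma is_derive1_add f g x df dg : is_derive x (1 : R) f df ->
  is_derive x (1 : R) g dg -> is_derive x (1 : R) (fun s => f s + g s) (df + dg).
Proof. exact: is_deriveD. Qed.

Lemma is_derive1_sub f g x df dg : is_derive x (1 : R) f df ->
  is_derive x (1 : R) g dg -> is_derive x (1 : R) (fun s => f s - g s) (df - dg).
Proof. exact: is_deriveB. Qed.

Lemma is_derive1_mul f g x df dg : is_derive x (1 : R) f df ->
  is_derive x (1 : R) g dg ->
  is_derive x (1 : R) (fun s => f s * g s) (df * g x + f x * dg).
Proof.
move=> hf hg; rewrite addrC [df * _]mulrC; exact: is_deriveM.
Qed.

Lemma is_derive1_cstr (c x : R) : is_derive x (1 : R) (fun=> c) 0.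
Proof. exact: is_derive_cst. Qed.

Lemma is_derive1_cstM (c : R) f x df : is_derive x (1 : R) f df ->
  is_derive x (1 : R) (fun s => c * f s) (c * df).
Proof.
move=> hf; have := is_derive1_mul (is_derive1_cstr c x) hf.
by rewrite mul0r add0r.
Qed.

Lemma is_derive1_sqr f x df : is_derive x (1 : R) f df ->
  is_derive x (1 : R) (fun s => f s ^+ 2) (2 * f x * df).
Proof.
move=> hf; have := is_derive1_mul hf hf.
have -> : df * f x + f x * df = 2 * f x * df by ring.
by under eq_fun do rewrite -expr2.
Qed.

Lemma is_derive1_fcomp f g x df dg : is_derive x (1 : R) f df ->
  is_derive (f x) (1 : R) g dg -> is_derive x (1 : R) (fun s => g (f s)) (dg * df).
Proof. by move=> hf hg; exact: (is_derive1_comp hg hf). Qed.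

Lemma continuous_fcomp f g x : {for x, continuous f} ->
  {for f x, continuous g} -> {for x, continuous (fun s => g (f s))}.
Proof. by move=> hf hg; exact: (continuous_comp hf hg). Qed.

Lemma is_derive1_cont {V : normedModType R} (h : R -> V) x (d : V) :
  is_derive x (1 : R) h d -> {for x, continuous h}.
Proof. by move=> [+ _]; move/derivable1_diffP/differentiable_continuous. Qed.

Lemma is_derive1_val {V : normedModType R} (h : R -> V) x (d : V) :
  is_derive x (1 : R) h d -> derive1 h x = d.
Proof. by move=> [_ <-]; rewrite derive1E. Qed.

Lemma smooth_on_near {V : normedModType R} I (h : R -> V) t :
  smooth_on I h -> t \in I ->
  \forall s \near t, forall k, is_derive s (1 : R) (derive1n k h) (derive1n k.+1 h s).
Proof.
move=> hI /hI; apply: filterS => s hs k.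
by rewrite derive1nS derive1E; exact/derivableP.
Qed.

Lemma smooth_on_at {V : normedModType R} I (h : R -> V) t k :
  smooth_on I h -> t \in I -> is_derive t (1 : R) (derive1n k h) (derive1n k.+1 h t).
Proof. by move=> hI tI; exact: (nbhs_singleton (smooth_on_near hI tI)). Qed.

Lemma proper_itvP I : proper_itv I -> exists p q, [/\ p < q, p \in I & q \in I].
Proof.
move=> [p Ip]; have [e /= e0 pe] := Ip; exists p, (p + e / 2); split.
- by rewrite ltrDl divr_gt0.
- by have := interior_subset Ip.
- apply: pe => /=; rewrite opprD addrA subrr add0r normrN gtr0_norm ?divr_gt0//.
  by rewrite ltr_pdivrMr// ltr_pMr// ltr1n.
Qed.

Lemma itvoo_interior I p q u : p \in I -> q \in I -> u \in `]p, q[%R ->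
  [set` I]° u.
Proof.
move=> pI qI upq; rewrite /interior/=; near=> s.
have : s \in `]p, q[%R by near: s; exact: near_in_itvoo.
rewrite in_itv/= => /andP[ps sq].
by apply: (interval_is_interval pI qI); rewrite !ltW.
Unshelve. all: by end_near. Qed.

Lemma interior_itv_itvoo I u : [set` I]° u ->
  exists p q, [/\ p \in I, q \in I & u \in `]p, q[%R].
Proof.
move=> Iu; have [e /= e0 ue] := Iu; exists (u - e / 2), (u + e / 2).
have e2 : 0 < e / 2 by rewrite divr_gt0.
have ee : e / 2 < e by rewrite ltr_pdivrMr// ltr_pMr// ltr1n.
split.
- by apply: ue => /=; rewrite opprB addrCA subrr addr0 gtr0_norm.
- by apply: ue => /=; rewrite opprD addrA subrr add0r normrN gtr0_norm.
- by rewrite in_itv/= gtrBl ltrDl e2.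
Qed.

Lemma interior_itv_convex I s t u : [set` I]° s -> [set` I]° t ->
  s <= u <= t -> [set` I]° u.
Proof.
move=> /interior_itv_itvoo[p [p' [pI _]]]; rewrite in_itv/= => /andP[ps _].
move=> /interior_itv_itvoo[q' [q [_ qI]]]; rewrite in_itv/= => /andP[_ tq].
move=> /andP[su ut]; apply: (itvoo_interior pI qI).
by rewrite in_itv/= (lt_le_trans ps su) (le_lt_trans ut tq).
Qed.

(** A proper interval is contained in the closure of its interior. This is how
identities obtained in the interior, by two-sided arguments, are transferred to
the endpoints. *)
Lemma continuous_eq0_interior_itv I h u : proper_itv I -> u \in I ->
  {for u, continuous h} -> (forall s, [set` I]° s -> h s = 0) -> h u = 0.
Proof.
move=> /proper_itvP[p [q [pq pI qI]]] uI hu h0.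
have [uq|qu] := ltP u q.
- have hr : h s @[s --> u^'+] --> h u by exact: cvg_at_right_filter.
  apply: (cvg_unique _ hr); first exact: norm_hausdorff.
  apply: cvg_near_cst; near=> s; apply/h0/(itvoo_interior uI qI).
  by rewrite in_itv/=; apply/andP; split; near: s;
    [exact: nbhs_right_gt|exact: nbhs_right_lt].
- have pu : p < u by exact: lt_le_trans qu.
  have hr : h s @[s --> u^'-] --> h u by exact: cvg_at_left_filter.
  apply: (cvg_unique _ hr); first exact: norm_hausdorff.
  apply: cvg_near_cst; near=> s; apply/h0/(itvoo_interior pI uI).
  by rewrite in_itv/=; apply/andP; split; near: s;
    [exact: nbhs_left_gt|exact: nbhs_left_lt].
Unshelve. all: by end_near. Qed.

(** At an endpoint of I the hypothesis h = c controls only one side; the value of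
the two-sided derivative is recovered from the continuity of dh. *)
Lemma derive_cst_on_itv I h dh c : proper_itv I ->
  (forall t, t \in I -> is_derive t (1 : R) h (dh t)) ->
  (forall t, t \in I -> {for t, continuous dh}) ->
  (forall t, t \in I -> h t = c) -> forall t, t \in I -> dh t = 0.
Proof.
move=> pI hd dc hc t tI; apply: (continuous_eq0_interior_itv pI tI (dc t tI)).
move=> s Is; have sI := interior_subset Is.
rewrite -(is_derive1_val (hd s sI)).
apply: (@is_derive1_val _ h s 0); apply: near_eq_is_derive (is_derive1_cstr c s).
by apply: filterS Is => r /hc ->.
Qed.

(** Intermediate value theorem. The sign is returned as a boolean exponent of
-1, the form of the signs in phi. *)
Lemma nonvanishing_sign (S : set R) h :
  (forall s t u, S s -> S t -> s <= u <= t -> S u) ->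
  (forall s, S s -> {for s, continuous h}) -> (forall s, S s -> h s != 0) ->
  exists e : bool, forall s, S s -> 0 < (-1) ^+ e * h s.
Proof.
move=> convS hc h0.
have [allpos|] := pselect (forall s, S s -> 0 < h s).
  by exists false => s /allpos; rewrite expr0 mul1r.
move=> /existsNP[s0 /not_implyP[Ss0 /negP]]; rewrite -leNgt le_eqVlt.
rewrite (negbTE (h0 s0 Ss0))/= => hs0; exists true => s Ss.
rewrite expr1 mulN1r oppr_gt0 ltNge; apply/negP => hs.
have ivt a b : a <= b -> S a -> S b -> Num.min (h a) (h b) <= 0 <= Num.max (h a) (h b) ->
    False.
  move=> ab Sa Sb mM.
  have cab : {within `[a, b], continuous h}.
    apply: continuous_in_subspaceT => r; rewrite inE/= in_itv/= => rab.
    exact/hc/(convS a b).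
  have [c] := IVT ab cab mM; rewrite in_itv/= => cab' hc0.
  by have := h0 c (convS _ _ _ Sa Sb cab'); rewrite hc0 eqxx.
have [ss0|s0s] := leP s s0.
- by apply: (ivt s s0) => //; rewrite ge_min le_max hs (ltW hs0) orbT.
- by apply: (ivt s0 s (ltW s0s)) => //; rewrite ge_min le_max hs (ltW hs0) orbT.
Qed.

Lemma derive_eq0_interior_cst I h :
  (forall s, [set` I]° s -> is_derive s (1 : R) h 0) ->
  forall s t, [set` I]° s -> [set` I]° t -> h s = h t.
Proof.
move=> hd s t; wlog st : s t / s <= t.
  by move=> H Is It; have [/H|/ltW/H] := leP s t => ->.
move=> Is It; have ist r : s <= r <= t -> [set` I]° r.
  exact: interior_itv_convex.
have [r| | c _] := @MVT_segment R h (fun=> 0) s t st.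
- by rewrite in_itv/= => /andP[sr rt]; apply/hd/ist; rewrite !ltW.
- apply: continuous_in_subspaceT => r; rewrite inE/= in_itv/= => /ist/hd.
  exact: is_derive1_cont.
- by rewrite mul0r => /subr0_eq ->.
Qed.

Lemma is_derive_interior_min I h s dh :
  (forall t, [set` I]° t -> derivable h t 1) -> [set` I]° s ->
  is_derive s (1 : R) h dh -> (forall t, t \in I -> h s <= h t) -> dh = 0.
Proof.
move=> hd Is hs hmin; have [p [q [pI qI spq]]] := interior_itv_itvoo Is.
rewrite -(is_derive1_val hs); apply: (is_derive1_val (h := h)).
apply: (@derive1_at_min R h p q s) => //.
- by move: spq; rewrite in_itv/= => /andP[ps sq]; rewrite ltW// (lt_trans ps).
- by move=> t tpq; apply/hd/(itvoo_interior pI qI).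
- by move=> t tpq; apply: hmin; exact: (interior_subset (itvoo_interior pI qI tpq)).
Qed.

(** Divide h^2 = k^2 by (t - s)^2: both sides are squares of difference quotients
at s, because h and k vanish there. *)
Lemma derive_sqr_eq_at_zero h (k : R -> R) s dh dk : is_derive s (1 : R) h dh ->
  is_derive s (1 : R) k dk -> h s = 0 -> k s = 0 ->
  (\forall t \near s, h t ^+ 2 = k t ^+ 2) -> dh ^+ 2 = dk ^+ 2.
Proof.
move=> [hd <-] [kd <-] hs0 ks0 hk.
have sqr_quotient (m : R -> R) : derivable m s (1 : R) -> m s = 0 ->
    (r^-1 ^+ 2 * m (r + s) ^+ 2) @[r --> 0^'] --> ('D_1 m s : R) ^+ 2.
  move=> md m0; rewrite expr2.
  have ml : (r^-1 * m (r + s)) @[r --> 0^'] --> ('D_1 m s : R).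
    move: md; rewrite /derivable /derive m0 /= => md.
    apply: cvg_trans md; apply: near_eq_cvg; apply: nearW => r.
    by rewrite /= [r *: _]mulr1 subr0.
  apply: cvg_trans (cvgM ml ml); apply: near_eq_cvg; apply: nearW => r.
  rewrite [LHS](_ : _ = (r^-1 * m (r + s)) * (r^-1 * m (r + s)))//; ring.
apply: (cvg_unique _ (sqr_quotient h hd hs0)); first exact: norm_hausdorff.
apply: cvg_trans (sqr_quotient k kd ks0); apply: near_eq_cvg.
have : \forall r \near (0 : R), h (r + s) ^+ 2 = k (r + s) ^+ 2.
  by move: hk; rewrite (near_shift 0) /= subr0.
move=> /nbhs_dnbhs; apply: filterS => r hkr.
by rewrite hkr.
Unshelve. all: by end_near. Qed.

(** Where h = +- k does not vanish, differentiating h^2 = k^2 gives h h' = k k'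
and one cancels h^2 after squaring; at a common zero use difference quotients. *)
Lemma derive_sqr_eq h (k : R -> R) s dh dk : is_derive s (1 : R) h dh ->
  is_derive s (1 : R) k dk ->
  (\forall t \near s, h t ^+ 2 = k t ^+ 2) -> dh ^+ 2 = dk ^+ 2.
Proof.
move=> hd kd hk; have hks : h s ^+ 2 = k s ^+ 2 := nbhs_singleton hk.
have [hs0|hs0] := eqVneq (h s) 0.
  apply: (derive_sqr_eq_at_zero hd kd) => //.
  by apply/eqP; rewrite -sqrf_eq0 -hks hs0 expr0n.
have h2 := near_eq_is_derive hk (is_derive1_sqr hd).
have k2 := is_derive1_sqr kd.
have E2 : 2 * h s * dh = 2 * k s * dk.
  by rewrite -(is_derive1_val h2) -(is_derive1_val k2).
have E : h s * dh = k s * dk.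
  by apply: (mulfI (_ : 2 != 0 :> R)); rewrite ?pnatr_eq0// !mulrA.
have : (h s * dh) ^+ 2 = (k s * dk) ^+ 2 by rewrite E.
by rewrite !exprMn -hks => /mulfI; apply; rewrite sqrf_eq0.
Qed.

End Calculus.

(** * The Minkowski product *)

Section Minkowski.
Context {R : realType}.
Implicit Types (v w : 'rV[R]_4).

Lemma minkC v w : mink v w = mink w v.
Proof. by rewrite /mink; ring. Qed.

Lemma minkDl v1 v2 w : mink (v1 + v2) w = mink v1 w + mink v2 w.
Proof. by rewrite /mink !mxE; ring. Qed.

Lemma minkZl (c : R) v w : mink (c *: v) w = c * mink v w.
Proof. by rewrite /mink !mxE; ring. Qed.

Lemma minkDr v w1 w2 : mink v (w1 + w2) = mink v w1 + mink v w2.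
Proof. by rewrite minkC minkDl !(minkC v). Qed.

Lemma minkZr (c : R) v w : mink v (c *: w) = c * mink v w.
Proof. by rewrite minkC minkZl (minkC v). Qed.

Lemma minkNl v w : mink (- v) w = - mink v w.
Proof. by rewrite -scaleN1r minkZl mulN1r. Qed.

Lemma minkNr v w : mink v (- w) = - mink v w.
Proof. by rewrite minkC minkNl minkC. Qed.

Lemma mink_e1l w : span_e2_e3_e4 w -> mink e1 w = 0.
Proof. by rewrite /span_e2_e3_e4 /mink /e1/= !mxE/= => ->; ring. Qed.

Lemma mink_e1r w : span_e2_e3_e4 w -> mink w e1 = 0.
Proof. by move/mink_e1l; rewrite minkC. Qed.

Lemma mink_e1 : mink (e1 : 'rV[R]_4) e1 = 1.
Proof. by rewrite /mink /e1 !mxE/=; ring. Qed.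

(** The vectors l, t, n form a basis of the 3-space: up to sign their Gram
determinant, which is -1, is the square of their determinant. *)
Lemma orthonormal_span_eq0 l t n w : span_e2_e3_e4 l -> span_e2_e3_e4 t ->
  span_e2_e3_e4 n -> span_e2_e3_e4 w ->
  mink l l = -1 -> mink t t = 1 -> mink n n = 1 ->
  mink t l = 0 -> mink n l = 0 -> mink n t = 0 ->
  mink w l = 0 -> mink w t = 0 -> mink w n = 0 -> w = 0.
Proof.
rewrite /span_e2_e3_e4 /mink /= => -> -> -> w0.
rewrite w0 !mul0r !add0r.
set l1 := l 0 1; set l2 := l 0 2; set l3 := l 0 3.
set t1 := t 0 1; set t2 := t 0 2; set t3 := t 0 3.
set n1 := n 0 1; set n2 := n 0 2; set n3 := n 0 3.
move=> ll tt nn tl nl nt wl wt wn.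
pose D := l1 * (t2 * n3 - t3 * n2) - l2 * (t1 * n3 - t3 * n1)
  + l3 * (t1 * n2 - t2 * n1).
(* The Gram determinant is the squared determinant times the determinant -1 of
   the metric. *)
have D2 : D ^+ 2 = 1.
  have -> : D ^+ 2 = - ((l1 * l1 + l2 * l2 - l3 * l3) *
     ((t1 * t1 + t2 * t2 - t3 * t3) * (n1 * n1 + n2 * n2 - n3 * n3)
      - (n1 * t1 + n2 * t2 - n3 * t3) ^+ 2)
    - (t1 * l1 + t2 * l2 - t3 * l3) *
     ((t1 * l1 + t2 * l2 - t3 * l3) * (n1 * n1 + n2 * n2 - n3 * n3)
      - (n1 * t1 + n2 * t2 - n3 * t3) * (n1 * l1 + n2 * l2 - n3 * l3))
    + (n1 * l1 + n2 * l2 - n3 * l3) *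
     ((t1 * l1 + t2 * l2 - t3 * l3) * (n1 * t1 + n2 * t2 - n3 * t3)
      - (t1 * t1 + t2 * t2 - t3 * t3) * (n1 * l1 + n2 * l2 - n3 * l3))).
    by rewrite /D; ring.
  by rewrite ll tt nn tl nl nt; ring.
have D0 : D != 0 by rewrite -sqrf_eq0 D2 oner_eq0.
(* Cramer's rule: D * w_i is a combination of the products of w with l, t and n,
   with minors as coefficients. *)
have cramer i : D * w 0 i = 0 -> w 0 i = 0.
  by move=> /eqP; rewrite mulf_eq0 (negbTE D0) => /eqP.
have w1 : w 0 1 = 0.
  apply: cramer; set x := w 0 1 in wl wt wn *; set y := w 0 2 in wl wt wn *.
  set z := w 0 3 in wl wt wn *.
  transitivity ((x * l1 + y * l2 - z * l3) * (t2 * n3 - t3 * n2)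
    - (x * t1 + y * t2 - z * t3) * (l2 * n3 - l3 * n2)
    + (x * n1 + y * n2 - z * n3) * (l2 * t3 - l3 * t2)); first by rewrite /D; ring.
  by rewrite wl wt wn; ring.
have w2 : w 0 2 = 0.
  apply: cramer; set x := w 0 1 in wl wt wn *; set y := w 0 2 in wl wt wn *.
  set z := w 0 3 in wl wt wn *.
  transitivity (- (x * l1 + y * l2 - z * l3) * (t1 * n3 - t3 * n1)
    + (x * t1 + y * t2 - z * t3) * (l1 * n3 - l3 * n1)
    - (x * n1 + y * n2 - z * n3) * (l1 * t3 - l3 * t1)); first by rewrite /D; ring.
  by rewrite wl wt wn; ring.
have w3 : w 0 3 = 0.
  apply: cramer; set x := w 0 1 in wl wt wn *; set y := w 0 2 in wl wt wn *.
  set z := w 0 3 in wl wt wn *.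
  transitivity (- (x * l1 + y * l2 - z * l3) * (t1 * n2 - t2 * n1)
    + (x * t1 + y * t2 - z * t3) * (l1 * n2 - l2 * n1)
    - (x * n1 + y * n2 - z * n3) * (l1 * t2 - l2 * t1)); first by rewrite /D; ring.
  by rewrite wl wt wn; ring.
apply/rowP => i; rewrite mxE.
case: i => -[|[|[|[|//]]]] i4.
- by rewrite -w0; congr (w _ _); exact: val_inj.
- by rewrite -w1; congr (w _ _); exact: val_inj.
- by rewrite -w2; congr (w _ _); exact: val_inj.
- by rewrite -w3; congr (w _ _); exact: val_inj.
Qed.

Lemma is_derive_coord (h : R -> 'rV[R]_4) x d (i : 'I_4) :
  is_derive x (1 : R) h d -> is_derive x (1 : R) (fun s => h s 0 i) (d 0 i).
Proof.
move=> [hd <-]; have hdi := (derivable_mxP _ _ _).1 hd 0 i.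
by rewrite derive_mx// mxE; exact/derivableP.
Qed.

Lemma is_derive_mink (h k : R -> 'rV[R]_4) x dh dk :
  is_derive x (1 : R) h dh -> is_derive x (1 : R) k dk ->
  is_derive x (1 : R) (fun s => mink (h s) (k s)) (mink dh (k x) + mink (h x) dk).
Proof.
move=> hd kd; rewrite /mink.
have H i := is_derive1_mul (is_derive_coord i hd) (is_derive_coord i kd).
have := is_derive1_sub (is_derive1_add (is_derive1_add (H 0) (H 1)) (H 2)) (H 3).
move=> /is_derive_eq; apply; ring.
Qed.

Lemma is_derive_scale_vec (h : R -> R) (w : 'rV[R]_4) x dh :
  is_derive x (1 : R) h dh -> is_derive x (1 : R) (fun s => h s *: w) (dh *: w).
Proof.
move=> hd; have hdi i j : is_derive x (1 : R) (fun s => (h s *: w) i j) (dh * w i j).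
  under eq_fun do rewrite mxE mulrC.
  by rewrite mulrC; exact: is_derive1_cstM.
have dv : derivable (fun s => h s *: w) x (1 : R).
  by apply/derivable_mxP => i j; have [] := hdi i j.
apply: DeriveDef => //; rewrite derive_mx//; apply/matrixP => i j; rewrite !mxE.
by have [_ ->] := hdi i j.
Qed.

Lemma derive1_scaleD (h k : R -> R) (v w : 'rV[R]_4) x dh dk :
  is_derive x (1 : R) h dh -> is_derive x (1 : R) k dk ->
  derive1 (fun s => h s *: v + k s *: w) x = dh *: v + dk *: w.
Proof.
move=> hd kd; apply: is_derive1_val.
exact: is_deriveD (is_derive_scale_vec v hd) (is_derive_scale_vec w kd).
Qed.

Lemma derive1_scale_vec (c : R) (h : R -> 'rV[R]_4) (w : 'rV[R]_4) x dh :
  is_derive x (1 : R) h dh -> derive1 (fun s => c *: h s + w) x = c *: dh.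
Proof.
move=> hd; apply: is_derive1_val; rewrite -[c *: dh]addr0.
exact: is_deriveD (is_deriveZ c hd) (is_derive_cst w x (1 : R)).
Qed.

End Minkowski.

(** * The curve on the hyperbolic plane and the derivatives of the surface *)

Section Frame.
Context {R : realType}.

Lemma smooth_on_derive1 {V : normedModType R} (I : interval R) (h : R -> V) :
  smooth_on I h -> smooth_on I (derive1 h).
Proof.
move=> hI t /hI; apply: filterS => s hs k.
by have := hs k.+1; rewrite /derive1n iterSr.
Qed.

Lemma mink_cst_on_itv (J : interval R) (h k : R -> 'rV[R]_4) c :
  proper_itv J -> smooth_on J h -> smooth_on J k ->
  (forall v, v \in J -> mink (h v) (k v) = c) ->
  forall v, v \in J -> mink (derive1 h v) (k v) + mink (h v) (derive1 k v) = 0.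
Proof.
move=> pJ sh sk hkc.
have dh v vJ := @smooth_on_at _ _ _ _ v 0 sh vJ.
have dk v vJ := @smooth_on_at _ _ _ _ v 0 sk vJ.
have ddh v vJ := @smooth_on_at _ _ _ _ v 1 sh vJ.
have ddk v vJ := @smooth_on_at _ _ _ _ v 1 sk vJ.
apply: (derive_cst_on_itv pJ _ _ hkc) => v vJ.
- exact: is_derive_mink (dh v vJ) (dk v vJ).
- apply: is_derive1_cont; apply: is_derive1_add.
    exact: is_derive_mink (ddh v vJ) (dk v vJ).
  exact: is_derive_mink (dh v vJ) (ddk v vJ).
Qed.

Lemma span_derive1 (J : interval R) (h : R -> 'rV[R]_4) :
  proper_itv J -> smooth_on J h ->
  (forall v, v \in J -> span_e2_e3_e4 (h v)) ->
  forall v, v \in J -> span_e2_e3_e4 (derive1 h v).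
Proof.
move=> pJ sh h0.
apply: (derive_cst_on_itv pJ _ _ h0) => v vJ.
- exact: is_derive_coord (@smooth_on_at _ _ _ _ v 0 sh vJ).
- exact: is_derive1_cont (is_derive_coord 0 (@smooth_on_at _ _ _ _ v 1 sh vJ)).
Qed.

Context (I J : interval R) (f g : R -> R) (l n : R -> 'rV[R]_4).
Context (hM : timelike_meridian_data I J f g l) (hn : normal_field J l n).

Let sf := meridian_smooth_f hM.
Let sg := meridian_smooth_g hM.
Let sl := meridian_smooth_l hM.
Let pI := meridian_dom_u hM.
Let pJ := meridian_dom_v hM.

Lemma mink_l_l v : v \in J -> mink (l v) (l v) = -1.
Proof. by move=> /(meridian_l_in hM)[]. Qed.

Lemma span_l v : v \in J -> span_e2_e3_e4 (l v).
Proof. by move=> /(meridian_l_in hM)[]. Qed.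

Lemma span_dl v : v \in J -> span_e2_e3_e4 (derive1 l v).
Proof. by apply: span_derive1 => //; exact: span_l. Qed.

Lemma span_ddl v : v \in J -> span_e2_e3_e4 (derive1 (derive1 l) v).
Proof.
apply: (span_derive1 pJ (smooth_on_derive1 sl)) => w; exact: span_dl.
Qed.

Lemma mink_dl_l v : v \in J -> mink (derive1 l v) (l v) = 0.
Proof.
move=> vJ; have := mink_cst_on_itv pJ sl sl mink_l_l vJ.
by rewrite [mink (l v) _]minkC; lra.
Qed.

Lemma mink_ddl_l v : v \in J -> mink (derive1 (derive1 l) v) (l v) = -1.
Proof.
move=> vJ; have := mink_cst_on_itv pJ (smooth_on_derive1 sl) sl mink_dl_l vJ.
by rewrite (meridian_l_unit hM vJ); lra.
Qed.

Lemma mink_ddl_dl v : v \in J -> mink (derive1 (derive1 l) v) (derive1 l v) = 0.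
Proof.
move=> vJ; have := mink_cst_on_itv pJ (smooth_on_derive1 sl)
  (smooth_on_derive1 sl) (meridian_l_unit hM) vJ.
by rewrite [X in _ + X]minkC; lra.
Qed.

(** Both sides have the same products with l, l' and n. *)
Lemma frenet_ddl v : v \in J ->
  derive1 (derive1 l) v = curvature l n v *: n v + l v.
Proof.
move=> vJ; apply/subr0_eq.
have ll := mink_l_l vJ; have tl := mink_dl_l vJ.
have al := mink_ddl_l vJ; have at0 := mink_ddl_dl vJ.
have tt := meridian_l_unit hM vJ.
have nn := normal_unit hn vJ; have nl := normal_orth_l hn vJ.
have nt := normal_orth_t hn vJ.
apply: (orthonormal_span_eq0 (span_l vJ) (span_dl vJ) (normal_in_span hn vJ)) => //.
- have := span_ddl vJ; have := span_l vJ; have := normal_in_span hn vJ.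
  by rewrite /span_e2_e3_e4/= !mxE => -> -> ->; rewrite mulr0 addr0 subr0.
- by rewrite minkDl minkNl minkDl minkZl al nl ll; ring.
- by rewrite minkDl minkNl minkDl minkZl at0 nt [mink (l v) _]minkC tl; ring.
- by rewrite minkDl minkNl minkDl minkZl nn [mink (l v) _]minkC nl /curvature; ring.
Qed.

Lemma mink_ddl_ddl v : v \in J ->
  mink (derive1 (derive1 l) v) (derive1 (derive1 l) v) = curvature l n v ^+ 2 - 1.
Proof.
by move=> vJ; rewrite [X in mink _ X](frenet_ddl vJ) minkDr minkZr mink_ddl_l.
Qed.

Lemma curvature_continuous v : v \in J -> {for v, continuous (curvature l n)}.
Proof.
move=> vJ; have d2 := @smooth_on_at _ _ _ _ v 2 sl vJ.
exact: is_derive1_cont (is_derive_mink d2 (@smooth_on_at _ _ _ _ v 0 (normal_smooth hn) vJ)).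
Qed.

(** Half the derivative of f'^2 - g'^2 = 1. *)
Lemma meridian_derive_normalized u : u \in I ->
  derive1 f u * derive1 (derive1 f) u = derive1 g u * derive1 (derive1 g) u.
Proof.
have df k s sI := @smooth_on_at _ _ _ _ s k sf sI.
have dg k s sI := @smooth_on_at _ _ _ _ s k sg sI.
move=> uI; pose dN s := 2 * derive1 f s * derive1 (derive1 f) s
  - 2 * derive1 g s * derive1 (derive1 g) s.
suff : dN u = 0.
  rewrite /dN -!mulrA -mulrBr => /eqP.
  by rewrite mulf_eq0 pnatr_eq0 subr_eq0 => /eqP.
apply: (derive_cst_on_itv pI _ _ (meridian_normalized hM) uI) => s sI.
- exact: is_derive1_sub (is_derive1_sqr (df 1 s sI)) (is_derive1_sqr (dg 1 s sI)).
- have cf := is_derive1_mul (is_derive1_cstM 2 (df 1 s sI)) (df 2 s sI).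
  have cg := is_derive1_mul (is_derive1_cstM 2 (dg 1 s sI)) (dg 2 s sI).
  exact: is_derive1_cont (is_derive1_sub cf cg).
Qed.

Let z := meridian_surface f g l.

Lemma partial_u_meridian u v : u \in I ->
  partial_u z u v = derive1 f u *: l v + derive1 g u *: e1.
Proof.
move=> uI; exact: derive1_scaleD (@smooth_on_at _ _ _ _ u 0 sf uI)
  (@smooth_on_at _ _ _ _ u 0 sg uI).
Qed.

Lemma partial_uu_meridian u v : u \in I ->
  partial_u (partial_u z) u v =
  derive1 (derive1 f) u *: l v + derive1 (derive1 g) u *: e1.
Proof.
move=> uI; have := derive1_scaleD (l v) e1
  (@smooth_on_at _ _ _ _ u 1 sf uI) (@smooth_on_at _ _ _ _ u 1 sg uI).
move=> <-; rewrite /partial_u !derive1E; apply: near_eq_derive.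
have nf := smooth_on_near sf uI; have ng := smooth_on_near sg uI.
apply: filterS (filterI nf ng) => s [dfs dgs].
exact: (derive1_scaleD (l v) e1 (dfs 0%N) (dgs 0%N)).
Qed.

Lemma partial_v_meridian u v : v \in J -> partial_v z u v = f u *: derive1 l v.
Proof.
by move=> vJ; exact: derive1_scale_vec (@smooth_on_at _ _ _ _ v 0 sl vJ).
Qed.

Lemma partial_vv_meridian u v : v \in J ->
  partial_v (partial_v z) u v = f u *: derive1 (derive1 l) v.
Proof.
move=> vJ; have := derive1_scale_vec (f u) 0 (@smooth_on_at _ _ _ _ v 1 sl vJ).
move=> <-; rewrite /partial_v !derive1E; apply: near_eq_derive.
have nl := smooth_on_near sl vJ.
apply: filterS nl => s dls; rewrite addr0.
have := derive1_scale_vec (f u) (g u *: e1) (dls 0%N); exact.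
Qed.

End Frame.

(** * The mean curvature *)

Section MeanCurvature.
Context {R : realType}.

(** normal_part as a function of two arbitrary tangent vectors: the computation
of H is then plain algebra on vectors, with no derivative in sight. *)
Definition normal_projection (zu zv w : 'rV[R]_4) : 'rV[R]_4 :=
  let D := mink zu zu * mink zv zv - mink zu zv ^+ 2 in
  w - ((mink zv zv * mink w zu - mink zu zv * mink w zv) / D) *: zu
    - ((mink zu zu * mink w zv - mink zu zv * mink w zu) / D) *: zv.

Lemma normal_projectionB zu zv w1 w2 :
  normal_projection zu zv w1 - normal_projection zu zv w2 =
  normal_projection zu zv (w1 - w2).
Proof.
rewrite /normal_projection !(minkDl w1 (- w2)) !minkNl.
apply/rowP => i; rewrite !mxE.
move: (mink zu zu) (mink zu zv) (mink zv zv) => E F G.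
move: (mink w1 zu) (mink w1 zv) (mink w2 zu) (mink w2 zv) => *.
by move: (_^-1) => *; ring.
Qed.

Lemma normal_projection_frameB (zu zv a b c : 'rV[R]_4) (X Y : R * R) :
  normal_projection zu zv ((X.1 * X.1) *: a + (X.1 * X.2 + X.2 * X.1) *: b
    + (X.2 * X.2) *: c)
  - normal_projection zu zv ((Y.1 * Y.1) *: a + (Y.1 * Y.2 + Y.2 * Y.1) *: b
    + (Y.2 * Y.2) *: c)
  = normal_projection zu zv ((X.1 ^+ 2 - Y.1 ^+ 2) *: a
      + (2 * (X.1 * X.2 - Y.1 * Y.2)) *: b + (X.2 ^+ 2 - Y.2 ^+ 2) *: c).
Proof.
rewrite normal_projectionB; congr normal_projection.
by apply/rowP => i; rewrite !mxE; ring.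
Qed.

Lemma mink_normal_projection (zu zv w : 'rV[R]_4) G :
  mink zu zu = -1 -> mink zu zv = 0 -> mink zv zv = G -> G != 0 ->
  mink (normal_projection zu zv w) (normal_projection zu zv w) =
  mink w w + mink w zu ^+ 2 - mink w zv ^+ 2 / G.
Proof.
move=> /= zuu zuv zvv G0.
rewrite /normal_projection zuu zuv zvv !minkDl !minkDr !minkNl !minkNr.
rewrite !minkZl !minkZr zuu zuv zvv (minkC zv zu) zuv (minkC zu w) (minkC zv w).
move: (mink w w) (mink w zu) (mink w zv) => p q r; field.
by rewrite G0.
Qed.

Lemma mink_comb (zu zv : 'rV[R]_4) a b c d :
  mink (a *: zu + b *: zv) (c *: zu + d *: zv) =
  a * c * mink zu zu + (a * d + b * c) * mink zu zv + b * d * mink zv zv.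
Proof. by rewrite !minkDl !minkDr !minkZl !minkZr (minkC zv zu); ring. Qed.

(** The matrix with columns (y1, F y2) and (x1, F x2) is a Lorentz matrix, and so
is its transpose: this turns the relations between the frame vectors into the
relations between their components that make H independent of the frame. *)
Lemma lorentz_frame_dual (F x1 x2 y1 y2 : R) : F != 0 ->
  F ^+ 2 * x2 ^+ 2 - x1 ^+ 2 = 1 -> F ^+ 2 * y2 ^+ 2 - y1 ^+ 2 = -1 ->
  F ^+ 2 * (x2 * y2) - x1 * y1 = 0 ->
  [/\ x1 ^+ 2 - y1 ^+ 2 = -1, x1 * x2 - y1 * y2 = 0
    & x2 ^+ 2 - y2 ^+ 2 = (F ^+ 2)^-1].
Proof.
move=> F0 xx yy xy.
have F20 : F ^+ 2 != 0 by rewrite sqrf_eq0.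
have h1 : y1 ^+ 2 - x1 ^+ 2 = 1.
  have : (F ^+ 2 * x2 ^+ 2) * (F ^+ 2 * y2 ^+ 2) = (x1 * y1) ^+ 2.
    by rewrite -(subr0_eq xy); ring.
  have -> : F ^+ 2 * x2 ^+ 2 = 1 + x1 ^+ 2 by rewrite -xx; ring.
  have -> : F ^+ 2 * y2 ^+ 2 = y1 ^+ 2 - 1 by rewrite -[X in _ - X]opprK -yy; ring.
  by rewrite exprMn => h; lra.
have h2 : F ^+ 2 * (x2 ^+ 2 - y2 ^+ 2) = 1 by lra.
split; first by lra.
- apply/eqP; rewrite -sqrf_eq0; apply/eqP.
  apply: (mulfI F20); rewrite mulr0.
  transitivity (x1 ^+ 2 * (F ^+ 2 * x2 ^+ 2) - 2 * (x1 * y1) * (F ^+ 2 * (x2 * y2))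
    + y1 ^+ 2 * (F ^+ 2 * y2 ^+ 2)); first by ring.
  have -> : F ^+ 2 * x2 ^+ 2 = 1 + x1 ^+ 2 by lra.
  have -> : F ^+ 2 * y2 ^+ 2 = x1 ^+ 2 by lra.
  rewrite (subr0_eq xy).
  have -> : y1 ^+ 2 = 1 + x1 ^+ 2 by lra.
  transitivity (2 * x1 ^+ 2 * (1 + x1 ^+ 2 - y1 ^+ 2)); first by ring.
  by rewrite (_ : 1 + x1 ^+ 2 - y1 ^+ 2 = 0) ?mulr0//; lra.
- by apply: (mulfI F20); rewrite h2 mulfV.
Qed.


(** The left-hand side is 4 <H, H> as it comes out of the projection, without the
use of a normal frame; the right-hand side shows the two normal components. *)
Lemma mean_curvature_algebra (F p q p' q' k : R) : F != 0 -> p != 0 ->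
  p ^+ 2 - q ^+ 2 = 1 -> p * p' = q * q' ->
  q' ^+ 2 - p' ^+ 2 + (k ^+ 2 - 1) / F ^+ 2 + 2 * p' / F + (p / F) ^+ 2 =
  (k ^+ 2 + ((p * q + F * q') / p) ^+ 2) / F ^+ 2.
Proof.
move=> F0 p0 pq pq'.
have -> : p' = q * q' / p by rewrite -pq' mulrC mulKf.
have -> : q' ^+ 2 - (q * q' / p) ^+ 2 = (q' / p) ^+ 2.
  transitivity ((p ^+ 2 - q ^+ 2) * (q' / p) ^+ 2); last by rewrite pq mul1r.
  by field.
have -> : (k ^+ 2 - 1) / F ^+ 2 = (k ^+ 2 - (p ^+ 2 - q ^+ 2)) / F ^+ 2 by rewrite pq.
by field; rewrite F0 p0.
Qed.

(** The relations of lorentz_frame_dual reduce H to half the normal part of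
- z_uu + z_vv / F^2; the mixed derivative zuv gets coefficient 0, so it can be
any vector. *)
Lemma mink_mean_curvature_frame (F p q p' q' k : R)
    (L T A zu zv zuu zuv zvv : 'rV[R]_4) (X Y : R * R) :
  F != 0 -> p != 0 -> p ^+ 2 - q ^+ 2 = 1 -> p * p' = q * q' ->
  span_e2_e3_e4 L -> span_e2_e3_e4 T -> span_e2_e3_e4 A ->
  mink L L = -1 -> mink T L = 0 -> mink T T = 1 ->
  mink A L = -1 -> mink A T = 0 -> mink A A = k ^+ 2 - 1 ->
  zu = p *: L + q *: e1 -> zv = F *: T ->
  zuu = p' *: L + q' *: e1 -> zvv = F *: A ->
  mink (X.1 *: zu + X.2 *: zv) (X.1 *: zu + X.2 *: zv) = 1 ->
  mink (Y.1 *: zu + Y.2 *: zv) (Y.1 *: zu + Y.2 *: zv) = -1 ->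
  mink (X.1 *: zu + X.2 *: zv) (Y.1 *: zu + Y.2 *: zv) = 0 ->
  4 * mink
    (2^-1 *: normal_projection zu zv ((X.1 ^+ 2 - Y.1 ^+ 2) *: zuu
      + (2 * (X.1 * X.2 - Y.1 * Y.2)) *: zuv + (X.2 ^+ 2 - Y.2 ^+ 2) *: zvv))
    (2^-1 *: normal_projection zu zv ((X.1 ^+ 2 - Y.1 ^+ 2) *: zuu
      + (2 * (X.1 * X.2 - Y.1 * Y.2)) *: zuv + (X.2 ^+ 2 - Y.2 ^+ 2) *: zvv))
  = (k ^+ 2 + ((p * q + F * q') / p) ^+ 2) / F ^+ 2.
Proof.
move=> F0 p0 pq pq' sL sT sA ll tl tt al at0 aa Ezu Ezv Ezuu Ezvv.
have le := mink_e1r sL; have te := mink_e1r sT; have ae := mink_e1r sA.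
have el := mink_e1l sL; have et := mink_e1l sT; have ea := mink_e1l sA.
have lt0 : mink L T = 0 by rewrite minkC.
have la : mink L A = -1 by rewrite minkC.
have ee := @mink_e1 R.
have Euu : mink zu zu = -1.
  rewrite Ezu !minkDl !minkDr !minkZl !minkZr ll el le ee.
  by transitivity (- (p ^+ 2 - q ^+ 2)); [ring|rewrite pq].
have Euv : mink zu zv = 0.
  by rewrite Ezu Ezv !minkDl !minkZl !minkZr lt0 et; ring.
have Evv : mink zv zv = F ^+ 2 by rewrite Ezv !minkZl !minkZr tt; ring.
rewrite !mink_comb Euu Euv Evv => xx yy xy.
have [-> -> ->] : [/\ X.1 ^+ 2 - Y.1 ^+ 2 = -1, X.1 * X.2 - Y.1 * Y.2 = 0
    & X.2 ^+ 2 - Y.2 ^+ 2 = (F ^+ 2)^-1].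
  apply: lorentz_frame_dual F0 _ _ _.
  - by rewrite -xx; ring.
  - by rewrite -yy; ring.
  - by rewrite -xy; ring.
rewrite mulr0 scale0r addr0 minkZl minkZr.
rewrite (mink_normal_projection _ Euu Euv Evv) ?sqrf_eq0//.
rewrite -(mean_curvature_algebra k F0 p0 pq pq').
have -> : mink (-1 *: zuu + (F ^+ 2)^-1 *: zvv) zu = - p / F.
  transitivity ((p * p' - q * q') - p / F); last by rewrite pq'; ring.
  rewrite Ezuu Ezvv Ezu !minkDl !minkDr !minkZl !minkDl !minkZl !minkZr.
  by rewrite ll al le el ee ae; field.
have -> : mink (-1 *: zuu + (F ^+ 2)^-1 *: zvv) zv = 0.
  rewrite Ezuu Ezvv Ezv !minkDl !minkZl !minkDl !minkZl !minkZr.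
  by rewrite lt0 et at0; ring.
have -> : mink (-1 *: zuu + (F ^+ 2)^-1 *: zvv) (-1 *: zuu + (F ^+ 2)^-1 *: zvv)
    = q' ^+ 2 - p' ^+ 2 + (k ^+ 2 - 1) / F ^+ 2 + 2 * p' / F.
  rewrite Ezuu Ezvv !minkDl !minkDr !minkZl !minkZr !minkDl !minkDr !minkZl !minkZr.
  by rewrite ll al la aa le el ee ae ea; field.
by field.
Qed.

Context (I J : interval R) (f g : R -> R) (l n : R -> 'rV[R]_4).
Context (hM : timelike_meridian_data I J f g l) (hn : normal_field J l n).
Let z := meridian_surface f g l.

(** f'^2 = 1 + g'^2. *)
Lemma meridian_df_neq0 u : u \in I -> derive1 f u != 0.
Proof.
move=> uI; have := meridian_normalized hM uI.
apply: contra_eq_neq => ->; rewrite expr0n/= sub0r; apply/negP => /eqP.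
by have := sqr_ge0 (derive1 g u); lra.
Qed.

(** The numerator is the derivative of f g': in this form the equation ||H|| = a
can be integrated. *)
Lemma mink_mean_curvature u v X Y : u \in I -> v \in J ->
  orthonormal_tangent_frame z u v X Y ->
  4 * mink (mean_curvature_vector z u v X Y) (mean_curvature_vector z u v X Y) =
  (curvature l n v ^+ 2 +
   ((derive1 f u * derive1 g u + f u * derive1 (derive1 g) u) / derive1 f u) ^+ 2)
  / f u ^+ 2.
Proof.
move=> uI vJ [xx yy xy].
have f0 : f u != 0 by rewrite gt_eqF// (meridian_f_gt0 hM).
have -> : mean_curvature_vector z u v X Y = 2^-1 *: normal_projection
    (partial_u z u v) (partial_v z u v)
    ((X.1 ^+ 2 - Y.1 ^+ 2) *: partial_u (partial_u z) u v
     + (2 * (X.1 * X.2 - Y.1 * Y.2)) *: partial_v (partial_u z) u v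
     + (X.2 ^+ 2 - Y.2 ^+ 2) *: partial_v (partial_v z) u v).
  exact: congr1 (normal_projection_frameB _ _ _ _ _ X Y).
exact: (mink_mean_curvature_frame _ f0 (meridian_df_neq0 uI)
  (meridian_normalized hM uI) (meridian_derive_normalized hM uI)
  (span_l hM vJ) (span_dl hM vJ) (span_ddl hM vJ)
  (mink_l_l hM vJ) (mink_dl_l hM vJ) (meridian_l_unit hM vJ)
  (mink_ddl_l hM vJ) (mink_ddl_dl hM vJ) (mink_ddl_ddl hM hn vJ)
  (partial_u_meridian hM v uI) (partial_v_meridian hM u vJ)
  (partial_uu_meridian hM v uI) (partial_vv_meridian hM u vJ) xx yy xy).
Qed.
End MeanCurvature.

(** * The differential equation of the meridian *)

Section Primitive.
Context {R : realType}.
Implicit Types (a b c t : R) (e : bool).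

Definition phi_sqrt a b t : R := Num.sqrt (4 * a ^+ 2 * t ^+ 2 - b ^+ 2).

(** The expression squared in phi. *)
Definition phi_primitive e a b c t : R :=
  c + (-1) ^+ e * (t / 2 * phi_sqrt a b t)
    - (-1) ^+ e * (b ^+ 2 / (4 * a) * ln `|2 * a * t + phi_sqrt a b t|).

Lemma is_derive_ln_norm (x : R) : 0 < x ->
  is_derive x (1 : R) (fun y => ln `|y|) x^-1.
Proof.
move=> x0; have := is_derive1_ln x0; apply: near_eq_is_derive.
near=> y; rewrite gtr0_norm//; near: y; exact: lt_nbhsr.
Unshelve. all: by end_near. Qed.

Lemma is_derive_phi_radicand a b t :
  is_derive t (1 : R) (fun s => 4 * a ^+ 2 * s ^+ 2 - b ^+ 2) (8 * a ^+ 2 * t).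
Proof.
have := is_derive1_sub (is_derive1_cstM (4 * a ^+ 2)
  (is_derive1_sqr (is_derive_id t (1 : R)))) (is_derive1_cstr (b ^+ 2) t).
by move=> /is_derive_eq; apply; ring.
Qed.

Lemma is_derive_phi_sqrt a b t : 0 < 4 * a ^+ 2 * t ^+ 2 - b ^+ 2 ->
  is_derive t (1 : R) (phi_sqrt a b) (4 * a ^+ 2 * t / phi_sqrt a b t).
Proof.
move=> r0; have r1 : phi_sqrt a b t != 0 by rewrite gt_eqF// sqrtr_gt0.
have := is_derive1_fcomp (is_derive_phi_radicand a b t) (is_derive1_sqrt r0).
move=> /is_derive_eq; apply; rewrite -/(phi_sqrt a b t).
by field.
Qed.

Lemma phi_sqrt_continuous a b t : {for t, continuous (phi_sqrt a b)}.
Proof.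
exact: continuous_fcomp (is_derive1_cont (is_derive_phi_radicand a b t))
  (@sqrt_continuous R _).
Qed.

Lemma phi_ln_arg_gt0 a b t : 0 < a -> 0 < t -> 0 < 2 * a * t + phi_sqrt a b t.
Proof. by move=> a0 t0; rewrite ltr_wpDr ?sqrtr_ge0// !mulr_gt0. Qed.

(** The derivative of t/2 r is r/2 + 2 a^2 t^2 / r and that of the logarithm is
2a / r; their combination is r/2 + (4 a^2 t^2 - b^2) / (2 r) = r. *)
Lemma is_derive_phi_primitive e a b c t : 0 < a -> 0 < t ->
  0 < 4 * a ^+ 2 * t ^+ 2 - b ^+ 2 ->
  is_derive t (1 : R) (phi_primitive e a b c) ((-1) ^+ e * phi_sqrt a b t).
Proof.
move=> a0 t0 r0; have dr := is_derive_phi_sqrt r0.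
have p0 := phi_ln_arg_gt0 b a0 t0.
have dln := is_derive1_fcomp
  (is_derive1_add (is_derive1_cstM (2 * a) (is_derive_id t (1 : R))) dr)
  (is_derive_ln_norm p0).
have dt := is_derive1_mul (is_derive1_mul (is_derive_id t (1 : R))
  (is_derive1_cstr 2^-1 t)) dr.
have := is_derive1_sub (is_derive1_add (is_derive1_cstr c t)
  (is_derive1_cstM ((-1) ^+ e) dt))
  (is_derive1_cstM ((-1) ^+ e) (is_derive1_cstM (b ^+ 2 / (4 * a)) dln)).
move=> /is_derive_eq; apply.
have r1 : phi_sqrt a b t != 0 by rewrite gt_eqF// sqrtr_gt0.
have r2 : b ^+ 2 = 4 * a ^+ 2 * t ^+ 2 - phi_sqrt a b t ^+ 2.
  by rewrite sqr_sqrtr ?(ltW r0)// subKr.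
move: (phi_sqrt a b t) r1 r2 p0 {dr dln dt} => r r1 -> /lt0r_neq0 p0.
have a1 := lt0r_neq0 a0.
by move: ((-1) ^+ e) => d; field; rewrite r1 p0 a1.
Qed.

(** The point t = |b| / (2a), where r vanishes and is not differentiable, is
included: at an endpoint of I only the nonnegativity of the radicand is known,
so the transfer of identities to the endpoints has to cover this case. *)
Lemma phi_primitive_continuous e a b c t : 0 < a -> 0 < t ->
  {for t, continuous (phi_primitive e a b c)}.
Proof.
move=> a0 t0; have rc := @phi_sqrt_continuous a b t.
have lc : {for t, continuous (fun s => ln `|2 * a * s + phi_sqrt a b s|)}.
  have ac : {for t, continuous (fun s => 2 * a * s + phi_sqrt a b s)}.
    by apply: cvgD rc; apply: cvgM; [exact: cvg_cst|exact: cvg_id].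
  exact: continuous_fcomp ac
    (is_derive1_cont (is_derive_ln_norm (phi_ln_arg_gt0 b a0 t0))).
apply: cvgB; last by apply: cvgM; [exact: cvg_cst|apply: cvgM lc; exact: cvg_cst].
apply: cvgD; first exact: cvg_cst.
apply: cvgM; first exact: cvg_cst.
by apply: cvgM rc; apply: cvgM; [exact: cvg_id|exact: cvg_cst].
Qed.

Lemma eq_sign_sqrt e (x y : R) : 0 < (-1) ^+ e * x -> x ^+ 2 = y ->
  x = (-1) ^+ e * Num.sqrt y.
Proof.
move=> ex <-; rewrite sqrtr_sqr; case: e ex.
  by rewrite expr1 !mulN1r oppr_gt0 => /ltr0_norm ->; rewrite opprK.
by rewrite expr0 !mul1r => /gtr0_norm.
Qed.

Context (I : interval R) (f g : R -> R) (a b : R).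
Context (pI : proper_itv I) (sf : smooth_on I f) (sg : smooth_on I g).
Context (f_gt0 : forall u, u \in I -> 0 < f u).
Context (normalized :
  forall u, u \in I -> derive1 f u ^+ 2 - derive1 g u ^+ 2 = 1).
Context (df_neq0 : forall u, u \in I -> derive1 f u != 0) (a_gt0 : 0 < a).

Let df s (sI : s \in I) := @smooth_on_at _ _ _ _ s 0 sf sI.
Let ddf s (sI : s \in I) := @smooth_on_at _ _ _ _ s 1 sf sI.
Let ddg s (sI : s \in I) := @smooth_on_at _ _ _ _ s 1 sg sI.

Let w s := f s * derive1 g s.
Let dw s := derive1 f s * derive1 g s + f s * derive1 (derive1 g) s.

Let w_derive s : s \in I -> is_derive s (1 : R) w (dw s).
Proof. by move=> sI; exact: is_derive1_mul (df sI) (ddg sI). Qed.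

Let dw_continuous s : s \in I -> {for s, continuous dw}.
Proof.
move=> sI; apply: is_derive1_cont.
apply: is_derive1_add (is_derive1_mul (ddf sI) (ddg sI)) (is_derive1_mul (df sI) _).
exact: @smooth_on_at _ _ _ _ s 2 sg sI.
Qed.

Let interiorI s : [set` I]° s -> s \in I.
Proof. exact: interior_subset. Qed.

(** A zero of the radicand in the interior would be a local minimum of it along
f, but its derivative 8 a^2 f f' is not zero. *)
Lemma radicand_gt0_interior :
  (forall u, u \in I -> 0 <= 4 * a ^+ 2 * f u ^+ 2 - b ^+ 2) ->
  forall u, [set` I]° u -> 0 < 4 * a ^+ 2 * f u ^+ 2 - b ^+ 2.
Proof.
move=> r0 u Iu; have uI := interiorI Iu.
rewrite lt_neqAle r0// andbT eq_sym; apply/negP => /eqP r_eq0.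
have dr s : s \in I -> is_derive s (1 : R)
    (fun s => 4 * a ^+ 2 * f s ^+ 2 - b ^+ 2) (8 * a ^+ 2 * f s * derive1 f s).
  by move=> sI; exact: is_derive1_fcomp (df sI) (is_derive_phi_radicand a b (f s)).
have /eqP : 8 * a ^+ 2 * f u * derive1 f u = 0.
  apply: (is_derive_interior_min _ Iu (dr u uI)).
  - by move=> s /interiorI/dr[].
  - by move=> s sI; rewrite r_eq0 r0.
have a0 := lt0r_neq0 a_gt0; have f0 := lt0r_neq0 (f_gt0 uI).
by apply/negP; rewrite !mulf_neq0 ?df_neq0 ?pnatr_eq0.
Qed.

Lemma phi_primitive_f_derive e c s : s \in I ->
  0 < 4 * a ^+ 2 * f s ^+ 2 - b ^+ 2 ->
  is_derive s (1 : R) (fun s => phi_primitive e a b c (f s))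
    ((-1) ^+ e * phi_sqrt a b (f s) * derive1 f s).
Proof.
move=> sI r0; have dp := is_derive_phi_primitive e c a_gt0 (f_gt0 sI) r0.
exact: is_derive1_fcomp (df sI) dp.
Qed.

(** The inner sign is that of w' / f' in the interior of I and the outer sign that
of f'. *)
Lemma meridian_given_by_phi_of_ode :
  (forall u, u \in I ->
     (dw u / derive1 f u) ^+ 2 = 4 * a ^+ 2 * f u ^+ 2 - b ^+ 2) ->
  meridian_given_by_phi I f g a b.
Proof.
move=> ode.
have r0 u : u \in I -> 0 <= 4 * a ^+ 2 * f u ^+ 2 - b ^+ 2.
  by move=> uI; rewrite -ode// sqr_ge0.
have r_gt0 := radicand_gt0_interior r0.
have [outer of_gt0] : exists e : bool, forall s, s \in I -> 0 < (-1) ^+ e * derive1 f s.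
  apply: (@nonvanishing_sign _ [set` I]) => //.
  - by move=> s t u sI tI sut; exact: (interval_is_interval sI tI).
  - by move=> s sI; exact: is_derive1_cont (ddf sI).
have [inner ig_gt0] : exists e : bool, forall s, [set` I]° s ->
    0 < (-1) ^+ e * (dw s / derive1 f s).
  apply: nonvanishing_sign.
  - by move=> s t u; exact: interior_itv_convex.
  - move=> s /interiorI sI; apply: cvgM; first exact: dw_continuous.
    by apply: cvgV; [exact: df_neq0|exact: is_derive1_cont (ddf sI)].
  - by move=> s Is; rewrite -sqrf_eq0 ode ?interiorI// gt_eqF// r_gt0.
pose d s := w s - phi_primitive inner a b 0 (f s).
have d_derive s : [set` I]° s -> is_derive s (1 : R) d 0.
  move=> Is; have sI := interiorI Is.
  have := is_derive1_sub (w_derive sI) (phi_primitive_f_derive inner 0 sI (r_gt0 s Is)).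
  move=> /is_derive_eq; apply.
  rewrite -(eq_sign_sqrt (ig_gt0 s Is) (ode s sI)).
  by rewrite divfK ?subrr ?df_neq0.
have [u0 Iu0] := pI.
(* d is constant in the interior; its value there is the integration constant. *)
exists outer, inner, (d u0) => u uI.
have wE : w u = phi_primitive inner a b (d u0) (f u).
  suff : d u - d u0 = 0.
    by move=> /subr0_eq <-; rewrite /d /phi_primitive; ring.
  apply: (@continuous_eq0_interior_itv _ I (fun s => d s - d u0)) => //.
    have pc := continuous_fcomp (is_derive1_cont (df uI))
      (phi_primitive_continuous (e := inner) (b := b) (c := 0) a_gt0 (f_gt0 uI)).
    apply: cvgB; last exact: cvg_cst.
    apply: cvgB; first exact: is_derive1_cont (w_derive uI).
    exact: pc.
  by move=> s Is; rewrite (derive_eq0_interior_cst d_derive Is Iu0) subrr.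
have g2 : derive1 f u ^+ 2 - 1 = derive1 g u ^+ 2.
  by rewrite -(normalized uI) subKr.
split; first exact: r0.
- apply: eq_sign_sqrt (of_gt0 u uI) _.
  rewrite -[LHS](subrK 1) g2 addrC -/(phi_primitive _ _ _ _ _) -wE /w exprMn.
  by rewrite mulKf// sqrf_eq0 lt0r_neq0// f_gt0.
- rewrite g2 sqrtr_sqr; have [g0|g0] := leP 0 (derive1 g u).
    by left; rewrite ger0_norm.
  by right; rewrite ltr0_norm// opprK.
Qed.

(** The equation f' = phi(f) determines w only up to a pointwise sign, so one
works with the squares of w and of phi_primitive. *)
Lemma ode_of_meridian_given_by_phi : meridian_given_by_phi I f g a b ->
  forall u, u \in I ->
    (dw u / derive1 f u) ^+ 2 = 4 * a ^+ 2 * f u ^+ 2 - b ^+ 2.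
Proof.
move=> [outer [inner [c hphi]]].
have r0 u : u \in I -> 0 <= 4 * a ^+ 2 * f u ^+ 2 - b ^+ 2.
  by move=> /hphi[].
have w2 s : s \in I -> w s ^+ 2 = phi_primitive inner a b c (f s) ^+ 2.
  move=> sI; have [_ fphi _] := hphi s sI.
  have f0 := lt0r_neq0 (f_gt0 sI).
  have : derive1 f s ^+ 2 =
      1 + (f s ^+ 2)^-1 * phi_primitive inner a b c (f s) ^+ 2.
    rewrite fphi /phi exprMn sqrr_sign mul1r sqr_sqrtr//.
    by rewrite addr_ge0// mulr_ge0 ?invr_ge0 ?sqr_ge0.
  rewrite -(subrK (derive1 g s ^+ 2) (derive1 f s ^+ 2)) normalized// => /addrI g2.
  by rewrite /w exprMn g2 mulVKf// sqrf_eq0.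
have ode_sqr u : u \in I ->
    dw u ^+ 2 - derive1 f u ^+ 2 * (4 * a ^+ 2 * f u ^+ 2 - b ^+ 2) = 0.
  move=> uI; apply: (@continuous_eq0_interior_itv _ I (fun u => dw u ^+ 2
     - derive1 f u ^+ 2 * (4 * a ^+ 2 * f u ^+ 2 - b ^+ 2))) => //.
    have cf2 := is_derive1_cont (is_derive1_fcomp (df uI) (is_derive_phi_radicand a b (f u))).
    have cdf := is_derive1_cont (is_derive1_sqr (ddf uI)).
    have cdw := continuous_fcomp (dw_continuous uI) (@exprn_continuous R 2 _).
    by apply: cvgB; [exact: cdw|exact: cvgM cdf cf2].
  move=> s Is; have sI := interiorI Is.
  have dp := phi_primitive_f_derive inner c sI (radicand_gt0_interior r0 Is).
  have := derive_sqr_eq (w_derive sI) dp _.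
  move=> /(_ _)->; last by apply: filterS Is => t; exact: w2.
  rewrite !exprMn sqrr_sign mul1r sqr_sqrtr ?r0// mulrC subrr//.
move=> u /[dup] uI /ode_sqr/subr0_eq E; have f0 := df_neq0 uI.
by rewrite exprMn E exprVn mulrAC mulfV ?mul1r// sqrf_eq0.
Qed.

End Primitive.

Theorem theorem7p2 (R : realType) (I J : interval R) (f g : R -> R)
    (l n : R -> 'rV[R]_4) (x y : R -> R -> R * R) (a : R)
    (hM : timelike_meridian_data I J f g l)
    (hn : normal_field J l n)
    (hxy : forall u v, u \in I -> v \in J ->
       orthonormal_tangent_frame (meridian_surface f g l) u v (x u v) (y u v))
    (hcurv : exists v, v \in J /\ curvature l n v != 0)
    (ha : 0 < a) :
  (forall u v, u \in I -> v \in J ->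
     mink_norm (mean_curvature_vector (meridian_surface f g l) u v
                  (x u v) (y u v)) = a)
  <->
  (exists b : R, [/\ b != 0,
     forall v, v \in J -> curvature l n v = b
   & meridian_given_by_phi I f g a b]).
Proof.
have f_gt0 := meridian_f_gt0 hM.
have H2 u v (uI : u \in I) (vJ : v \in J) :=
  mink_mean_curvature hM hn uI vJ (hxy u v uI vJ).
have norm_eq u v : u \in I -> v \in J ->
    mink_norm (mean_curvature_vector (meridian_surface f g l) u v (x u v) (y u v)) = a
    <-> ((derive1 f u * derive1 g u + f u * derive1 (derive1 g) u) / derive1 f u) ^+ 2
      = 4 * a ^+ 2 * f u ^+ 2 - curvature l n v ^+ 2.
  move=> uI vJ; have := H2 u v uI vJ; rewrite /mink_norm.
  move: (mink _ _) (_ / derive1 f u) (curvature l n v) => h q k hE.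
  have F0 : f u ^+ 2 != 0 by rewrite sqrf_eq0 lt0r_neq0// f_gt0.
  have hF : 4 * h * f u ^+ 2 = k ^+ 2 + q ^+ 2 by rewrite hE divfK.
  have h0 : 0 <= h.
    have : 0 <= 4 * h by rewrite hE divr_ge0 ?addr_ge0 ?sqr_ge0.
    by rewrite pmulr_rge0.
  split=> [ha2|qE].
    by rewrite -ha2 sqr_sqrtr// hF addrC addKr.
  have : h = a ^+ 2.
    apply: (mulfI (_ : 4 != 0 :> R)); first by rewrite pnatr_eq0.
    by apply: (mulIf F0); rewrite hF qE addrC subrK.
  by move=> ->; rewrite sqrtr_sqr gtr0_norm.
have ode_phi b := @meridian_given_by_phi_of_ode R I f g a b (meridian_dom_u hM)
  (meridian_smooth_f hM) (meridian_smooth_g hM) f_gt0 (meridian_normalized hM)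
  (fun u => @meridian_df_neq0 R I J f g l hM u) ha.
have phi_ode b := @ode_of_meridian_given_by_phi R I f g a b (meridian_dom_u hM)
  (meridian_smooth_f hM) (meridian_smooth_g hM) f_gt0 (meridian_normalized hM)
  (fun u => @meridian_df_neq0 R I J f g l hM u) ha.
split=> [Ha|[b [b0 kb mer]] u v uI vJ]; last first.
  by apply/(norm_eq u v uI vJ); rewrite kb//; exact: phi_ode.
(* Fixing u = u0 shows that k^2 does not depend on v. *)
have [v0 [v0J k0]] := hcurv; have [u0 [_ [_ u0I _]]] := proper_itvP (meridian_dom_u hM).
have k2 v : v \in J -> curvature l n v ^+ 2 = curvature l n v0 ^+ 2.
  move=> vJ; have /(norm_eq _ _ u0I vJ) := Ha u0 v u0I vJ.
  have /(norm_eq _ _ u0I v0J) -> := Ha u0 v0 u0I v0J.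
  by move=> /addrI /oppr_inj.
have [e ke] : exists e : bool, forall v, v \in J -> 0 < (-1) ^+ e * curvature l n v.
  apply: (@nonvanishing_sign _ [set` J]).
  - by move=> s t u sJ tJ sut; exact: (interval_is_interval sJ tJ).
  - by move=> v vJ; exact: (curvature_continuous hM hn).
  - by move=> v vJ; rewrite -sqrf_eq0 k2// sqrf_eq0.
exists (curvature l n v0); split=> // [v vJ|].
  by rewrite (eq_sign_sqrt (ke v vJ) (k2 v vJ)) -(eq_sign_sqrt (ke v0 v0J) erefl).
by apply: ode_phi => u uI; apply/norm_eq => //; exact: Ha.
Qed.
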